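(* Let $d\ge 1$, let $(l_n)_{n\ge1}$ be a decreasing sequence of positive reals, let $(\xi_n)_{n\ge1}$ be independent random variables uniformly distributed on $\mathbb{T}^d$, let $E=\limsup_{n\to\infty}B(\xi_n,l_n/2)$ be the associated random covering set, and let $\alpha=\alpha(l_n)$. If $F\subset\mathbb{T}^d$ is an analytic set with $\dim_H(F)>d-\alpha$, then $E\cap F\neq\emptyset$ almost surely.
   Context: $\mathbb{T}^d$ is the $d$-dimensional torus with its usual (quotient Euclidean) metric and Lebesgue probability measure. $B(x,r)$ is the closed ball of centre $x$ and radius $r$ in $\mathbb{T}^d$. ''Decreasing'' means non-increasing. With $g_n=B(0,l_n/2)$ and $G_n=g_n+\xi_n=B(\xi_n,l_n/2)$, the random covering set is $E=\limsup_{n\to\infty}G_n=\bigcap_{n=1}^\infty\bigcup_{k=n}^\infty G_k$, the set of points covered infinitely often. The exponent is $\alpha(l_n)=\sup\{0\le s\le d:\sum_{n=1}^\infty l_n^s=\infty\}$, which is known to be the almost sure Hausdorff dimension of $E$. $\dim_H$ denotes Hausdorff dimension, with $\dim_H\emptyset=0$. *)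

(* Defs.v *)
From HB Require Import structures.
From mathcomp Require Import all_boot all_order all_algebra.
From mathcomp Require Import all_classical all_reals all_analysis.
From mathcomp Require Import ring lra zify.

Set Implicit Arguments.
Unset Strict Implicit.
Unset Printing Implicit Defensive.

Import Order.TTheory GRing.Theory Num.Theory.
Import numFieldNormedType.Exports.

Local Open Scope quotient_scope.
Local Open Scope classical_set_scope.
Local Open Scope ring_scope.

Section euclidean.
Context {R : realType} {d : nat}.
Implicit Types x y : 'rV[R]_d.

(* The library norm on 'rV[R]_d is the sup norm, hence this Euclidean norm. *)
Definition enorm x : R := Num.sqrt (\sum_i x 0 i ^+ 2).

Lemma sumsq_ge0 x : 0 <= \sum_i x 0 i ^+ 2.
Proof. by apply: sumr_ge0 => i _; exact: sqr_ge0. Qed.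

Lemma enorm_ge0 x : 0 <= enorm x.
Proof. exact: sqrtr_ge0. Qed.

Lemma enorm_sqr x : enorm x ^+ 2 = \sum_i x 0 i ^+ 2.
Proof. by rewrite sqr_sqrtr// sumsq_ge0. Qed.

Lemma enorm0 : enorm 0 = 0.
Proof. by rewrite /enorm big1 ?sqrtr0// => i _; rewrite mxE expr0n. Qed.

Lemma enormN x : enorm (- x) = enorm x.
Proof. by congr Num.sqrt; apply: eq_bigr => i _; rewrite mxE sqrrN. Qed.

Lemma ler_coord_enorm x i : `|x 0 i| <= enorm x.
Proof.
rewrite -sqrtr_sqr ler_sqrt; last exact: sumsq_ge0.
by rewrite (bigD1 i)//= lerDl sumr_ge0// => j _; exact: sqr_ge0.
Qed.

Lemma enorm_le_sum x : enorm x <= \sum_i `|x 0 i|.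
Proof.
have s0 : 0 <= \sum_i `|x 0 i| by exact: sumr_ge0.
rewrite -(@ler_pXn2r _ 2) ?nnegrE ?enorm_ge0// enorm_sqr expr2 mulr_suml.
apply: ler_sum => i _; rewrite -real_normK ?num_real// expr2.
rewrite ler_wpM2l// (bigD1 i)//= lerDl; exact: sumr_ge0.
Qed.

Lemma cauchy_schwarz x y : \sum_i x 0 i * y 0 i <= enorm x * enorm y.
Proof.
set a := enorm x; set b := enorm y; set s := \sum_i _.
have a0 : 0 <= a by exact: enorm_ge0.
have b0 : 0 <= b by exact: enorm_ge0.
have E : \sum_i (b * x 0 i - a * y 0 i) ^+ 2 = 2 * (a * b) * (a * b - s).
  transitivity (\sum_i (b ^+ 2 * x 0 i ^+ 2 +
      (- (2 * (a * b))) * (x 0 i * y 0 i) + a ^+ 2 * y 0 i ^+ 2)).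
    by apply: eq_bigr => i _; ring.
  rewrite !big_split/= -!mulr_sumr -!enorm_sqr -/a -/b -/s; ring.
have [a00|a_neq0] := eqVneq a 0.
  have x0 i : x 0 i = 0.
    by apply/normr0_eq0/le_anti; rewrite normr_ge0 -a00 ler_coord_enorm.
  by rewrite a00 mul0r /s big1// => i _; rewrite x0 mul0r.
have [b00|b_neq0] := eqVneq b 0.
  have y0 i : y 0 i = 0.
    by apply/normr0_eq0/le_anti; rewrite normr_ge0 -b00 ler_coord_enorm.
  by rewrite b00 mulr0 /s big1// => i _; rewrite y0 mulr0.
have ab0 : 0 < 2 * (a * b).
  by rewrite !mulr_gt0// lt_neqAle eq_sym ?a_neq0 ?b_neq0.
have : 0 <= \sum_i (b * x 0 i - a * y 0 i) ^+ 2.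
  by apply: sumr_ge0 => i _; exact: sqr_ge0.
by rewrite E pmulr_rge0// subr_ge0.
Qed.

Lemma enormD x y : enorm (x + y) <= enorm x + enorm y.
Proof.
rewrite -(@ler_pXn2r _ 2) ?nnegrE ?addr_ge0 ?enorm_ge0// sqrrD !enorm_sqr.
have -> : \sum_i (x + y) 0 i ^+ 2 =
    \sum_i (x 0 i ^+ 2 + 2 * (x 0 i * y 0 i) + y 0 i ^+ 2).
  by apply: eq_bigr => i _; rewrite mxE; ring.
rewrite !big_split/= -mulr_sumr mulr_natl lerD2r lerD2l ler_pMn2r//.
exact: cauchy_schwarz.
Qed.

End euclidean.

Section lattice.
Variables (R : realType) (d : nat).

Definition lattice_rel : rel 'rV[R]_d :=
  fun x y => [forall i, (x 0 i - y 0 i) \is a Num.int].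

Lemma lattice_refl : reflexive lattice_rel.
Proof. by move=> x; apply/forallP => i; rewrite subrr rpred0. Qed.

Lemma lattice_sym : symmetric lattice_rel.
Proof.
by move=> x y; apply/forallP/forallP => h i; rewrite -opprB rpredN.
Qed.

Lemma lattice_trans : transitive lattice_rel.
Proof.
move=> y x z /forallP xy /forallP yz; apply/forallP => i.
by rewrite -(subrK (y 0 i) (x 0 i)) -addrA rpredD.
Qed.

Canonical lattice_equiv : equiv_rel 'rV[R]_d :=
  EquivRel lattice_rel lattice_refl lattice_sym lattice_trans.

Definition torus := {eq_quot lattice_equiv}.

HB.instance Definition _ := Choice.on torus.
HB.instance Definition _ := Quotient.on torus.
HB.instance Definition _ := EqQuotient.on torus.

Definition tpi : 'rV[R]_d -> torus := \pi_torus%qT.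

HB.instance Definition _ := isPointed.Build torus (tpi 0).

Lemma tpiP x y : tpi x = tpi y <-> forall i, (x 0 i - y 0 i) \is a Num.int.
Proof.
split=> [/eqmodP/forallP//|h].
by apply/eqmodP/forallP.
Qed.

Lemma tpi_repr (p : torus) : tpi (repr p) = p.
Proof. exact: reprK. Qed.

Definition rep_dists (p q : torus) : set R :=
  [set enorm (x - y) | x in tpi @^-1` [set p] & y in tpi @^-1` [set q]].

(* Quotient metric: Euclidean distance between two cosets of Z^d in R^d. *)
Definition tdist (p q : torus) : R := inf (rep_dists p q).

End lattice.

Arguments tpi {R d}.

Section torus_metric.
Context {R : realType} {d : nat}.
Implicit Types p q r : torus R d.

Lemma rep_dists_lb p q : lbound (rep_dists p q) 0.
Proof. by move=> _ [x _ [y _ <-]]; exact: enorm_ge0. Qed.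

Lemma rep_dists_inf p q : has_inf (rep_dists p q).
Proof.
split; last by exists 0; exact: rep_dists_lb.
by exists (enorm (repr p - repr q)); exists (repr p);
  [exact: tpi_repr|exists (repr q) => //; exact: tpi_repr].
Qed.

Lemma tdist_le (x y : 'rV[R]_d) : tdist (tpi x) (tpi y) <= enorm (x - y).
Proof. by apply: ge_inf; [exact: (rep_dists_inf _ _).2|exists x => //; exists y]. Qed.

Lemma tdist_ge0 p q : 0 <= tdist p q.
Proof. by apply: lb_le_inf; [exact: (rep_dists_inf p q).1|exact: rep_dists_lb]. Qed.

Lemma tdistxx p : tdist p p = 0.
Proof.
apply/le_anti; rewrite tdist_ge0 andbT -(tpi_repr p).
by rewrite (le_trans (tdist_le _ _))// subrr enorm0.
Qed.

Lemma tdist_sym p q : tdist p q = tdist q p.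
Proof.
by congr inf; apply/seteqP; split => _ [x xp [y yq <-]];
  exists y => //; exists x => //; rewrite -enormN opprB.
Qed.

Lemma tdist_triangle q p r : tdist p r <= tdist p q + tdist q r.
Proof.
apply/ler_addgt0Pl => e e0; have e20 : 0 < e / 2 by rewrite divr_gt0.
have [_ [x xp [y yq <-]] xy] := inf_adherent e20 (rep_dists_inf p q).
have [_ [y' yq' [z zr <-]] yz] := inf_adherent e20 (rep_dists_inf q r).
rewrite -/(tdist p q) -/(tdist q r) /= in xy yz xp yq yq' zr.
have yy : tpi (z + (y - y')) = r.
  rewrite -zr; apply/tpiP => i; rewrite !mxE.
  rewrite (_ : _ - _ = y 0 i - y' 0 i); last by ring.
  by have /tpiP/(_ i) : tpi y = tpi y' by rewrite yq yq'.
have := tdist_le x (z + (y - y')); rewrite xp yy => /le_trans; apply.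
have -> : x - (z + (y - y')) = (x - y) + (y' - z).
  by apply/matrixP => i j; rewrite !mxE; ring.
by apply: (le_trans (enormD _ _)); lra.
Qed.

Lemma notint_gap (v : R) : v \isn't a Num.int ->
  exists2 e : R, 0 < e & forall w, w - v \is a Num.int -> e <= `|w|.
Proof.
move=> vint; pose f := v - (Num.floor v)%:~R.
have f0 : 0 < f.
  rewrite subr_gt0 lt_neqAle floor_le andbT.
  by apply: contra vint => /eqP <-; exact: intr_int.
have f1 : f < 1 by rewrite ltrBlDl; have := floorD1_gt v; rewrite intrD.
exists (Num.min f (1 - f)); first by rewrite lt_min f0 subr_gt0.
move=> w /intrP[k wk].
have {wk} -> : w = f + (k + Num.floor v)%:~R.
  by rewrite intrD /f -wk; ring.
have [k0|k0] := leP 0 (k + Num.floor v).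
  rewrite ge_min; apply/orP; left.
  have k0' : 0 <= (k + Num.floor v)%:~R :> R by rewrite ler0z.
  by rewrite ger0_norm; lra.
rewrite ge_min; apply/orP; right.
have k0' : (k + Num.floor v)%:~R <= -1 :> R.
  by rewrite -[-1]/((-1)%:~R) ler_int; move: k0; rewrite -ltzD1 ?lezD1; lia.
by rewrite ler0_norm; lra.
Qed.

Lemma tdist_positivity p q : tdist p q = 0 -> p = q.
Proof.
rewrite -{2}(tpi_repr p) -{2}(tpi_repr q) => pq0; apply/tpiP => i.
apply: contrapT => /negP /notint_gap[e e0 gap].
have [_ [x xp [y yq <-]]] := inf_adherent e0 (rep_dists_inf p q).
rewrite -/(tdist p q) pq0 add0r ltNge => /negP; apply.
rewrite (le_trans _ (ler_coord_enorm _ i))//; apply: gap; rewrite !mxE.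
have /tpiP/(_ i) hx : tpi x = tpi (repr p) by rewrite tpi_repr.
have /tpiP/(_ i) hy : tpi y = tpi (repr q) by rewrite tpi_repr.
rewrite (_ : _ - _ = (x 0 i - repr p 0 i) - (y 0 i - repr q 0 i)).
  exact: rpredB hx hy.
by ring.
Qed.

End torus_metric.

HB.instance Definition _ (R : realType) (d : nat) :=
  @isMetric.Build R (torus R d) (@tdist R d) tdistxx tdist_positivity
    tdist_sym tdist_triangle.

Definition torus_display : measure_display.
Proof. exact: default_measure_display. Qed.

Section torus_borel.
Variables (R : realType) (d : nat).

Definition torus_borel : set (set (torus R d)) := <<s @open (torus R d) >>.

Let torus_borel0 : torus_borel set0.
Proof. exact: sigma_algebra0. Qed.

Let torus_borelC A : torus_borel A -> torus_borel (~` A).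
Proof. exact: sigma_algebraC. Qed.

Let torus_borel_bigcup (A : (set (torus R d))^nat) :
  (forall i, torus_borel (A i)) -> torus_borel (\bigcup_i A i).
Proof. exact: sigma_algebra_bigcup. Qed.

HB.instance Definition _ := @isMeasurable.Build torus_display (torus R d)
  torus_borel torus_borel0 torus_borelC torus_borel_bigcup.

End torus_borel.

Section torus_lebesgue.
Context {R : realType}.

Local Notation mR := (measurableTypeR R).

Definition tuple_of_cons n (xt : mR * n.-tuple mR) : n.+1.-tuple mR :=
  [the n.+1.-tuple mR of xt.1 :: xt.2].

Lemma measurable_tuple_of_cons n : measurable_fun setT (@tuple_of_cons n).
Proof. by apply: measurable_cons. Qed.

HB.instance Definition _ n := @isMeasurableFun.Build _ _ _ _ (@tuple_of_cons n)
  (@measurable_tuple_of_cons n).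

(* n-fold product of Lebesgue measure on [0, 1]; its image under the projection
   R^d -> R^d / Z^d is the Lebesgue probability measure of the torus. *)
Fixpoint cube_prob n : probability (n.-tuple mR) R :=
  match n with
  | 0%N => dirac ([tuple] : 0.-tuple mR)
  | m.+1 => distribution
      (uniform_prob (@ltr01 R) \x cube_prob m)%E (@tuple_of_cons m)
  end.

Definition torus_proj d (t : d.-tuple mR) : torus R d :=
  tpi (\row_i (tnth t i : R)).

Let box d (q : d.-tuple rat * nat) : set (d.-tuple mR) :=
  [set t | forall i, `|(tnth t i : R) - ratr (tnth q.1 i)| < q.2.+1%:R^-1].

Let measurable_box d (q : d.-tuple rat * nat) : measurable (box q).
Proof.
rewrite (_ : box q = \big[setI/setT]_(i < d) ((fun t => tnth t i) @^-1`
    `](ratr (tnth q.1 i) - q.2.+1%:R^-1), (ratr (tnth q.1 i) + q.2.+1%:R^-1)[)).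
  apply: bigsetI_measurable => i _; rewrite -[X in measurable X]setTI.
  by apply: (measurable_tnth i) => //; exact: measurable_itv.
apply/seteqP; split => t.
  move=> qt; rewrite -bigcap_seq => i _ /=.
  by rewrite in_itv/= -ltr_distl; exact: qt.
rewrite -bigcap_seq => qt i.
by have /= := qt i (mem_index_enum i); rewrite in_itv/= -ltr_distl.
Qed.

Lemma measurable_torus_proj d : measurable_fun setT (@torus_proj d).
Proof.
apply: (measurability (@open (torus R d))) => // _ [U oU <-]; rewrite setTI.
set V := _ @^-1` _.
have -> : V = \bigcup_(q in [set: d.-tuple rat * nat])
    (if pselect (box q `<=` V) then box q else set0).
  apply/seteqP; split=> [t Vt|t [q _]]; last first.
    by case: pselect => [qV /qV|].
  have := oU; rewrite openE => /(_ _ Vt); rewrite /interior -nbhs_ballE.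
  case=> e /= e0 eU; pose m := Num.truncn (d%:R * 2 / e).
  have m0 : 0 < m.+1%:R^-1 :> R by rewrite invr_gt0.
  have me : d%:R * (2 * m.+1%:R^-1) < e.
    rewrite mulrA ltr_pdivrMr// [ltRHS]mulrC -ltr_pdivrMr//; exact: truncnS_gt.
  have /choice[q tq] : forall i : 'I_d, exists q : rat,
      `|(tnth t i : R) - ratr q| < m.+1%:R^-1.
    move=> i; set ti : R := tnth t i.
    have [|q] := @rat_in_itvoo R (ti - m.+1%:R^-1) (ti + m.+1%:R^-1).
      by rewrite ltrD2l gtrN.
    by rewrite in_itv/= => tq; exists q; rewrite distrC ltr_distl.
  exists ([tuple q i | i < d], m) => //.
  case: pselect => [_ i /=|]; first by rewrite tnth_mktuple.
  case=> s /= bs; apply: eU; rewrite ballEmdist /=.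
  apply: le_lt_trans (tdist_le _ _) _.
  apply: le_lt_trans (enorm_le_sum _) _.
  apply: le_lt_trans me.
  rewrite -[d in leRHS]card_ord -sum1_card natr_sum mulr_suml.
  apply: ler_sum => i _; rewrite !mxE mul1r.
  have aux (a b c r : R) : `|a - c| < r -> `|b - c| < r -> `|a - b| <= 2 * r.
    by rewrite !ltr_norml ler_norml => /andP[? ?] /andP[? ?]; apply/andP; lra.
  by apply: (aux _ _ _ _ (tq i)); have := bs i; rewrite /= tnth_mktuple.
apply: countable_bigcupT_measurable; first exact: countableP.
by move=> q; case: pselect => ?; [exact: measurable_box|exact: measurable0].
Qed.

HB.instance Definition _ d := @isMeasurableFun.Build _ _ _ _ (@torus_proj d)
  (@measurable_torus_proj d).

Definition torus_lebesgue d : probability (torus R d) R :=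
  distribution (cube_prob d) (@torus_proj d).

End torus_lebesgue.

Section hausdorff_dimension.
Local Open Scope ereal_scope.
Context {R : realType} {T : metricType R}.
Implicit Types (A U : set T) (s delta : R).

(* The diameter of set0 is -oo here; hausdorff_weight treats set0 apart, so
   that the empty set weighs 0 (also for s = 0). *)
Definition diameter U : \bar R :=
  ereal_sup [set (mdist x y)%:E | x in U & y in U].

Definition hausdorff_weight s U : \bar R :=
  if U == set0 then 0 else diameter U `^ s.

Definition hausdorff_cover delta A : set (set T)^nat :=
  [set U | (forall i, diameter (U i) <= delta%:E) /\ A `<=` \bigcup_i U i].

Definition hausdorff_premeasure s delta A : \bar R :=
  ereal_inf [set \sum_(0 <= i <oo) hausdorff_weight s (U i)
            | U in hausdorff_cover delta A].

Definition hausdorff_measure s A : \bar R :=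
  ereal_sup [set hausdorff_premeasure s delta A | delta in [set e | 0 < e]%R].

Definition hausdorff_dim A : \bar R :=
  ereal_inf [set s%:E | s in [set s | (0 <= s)%R /\ hausdorff_measure s A = 0]].

End hausdorff_dimension.

(* {ptws nat -> nat} is the Baire space. *)
Definition analytic (T : topologicalType) (A : set T) : Prop :=
  A = set0 \/ exists2 f : {ptws nat -> nat} -> T, continuous f & A = range f.

Section random_covering.

Definition mutually_independent (R : realType) (d d' : measure_display)
    (Omega : measurableType d) (T : measurableType d') (I : eqType)
    (P : probability Omega R) (X : I -> {RV P >-> T}) : Prop :=
  forall (J : seq I) (A : I -> set T), uniq J ->
    (forall i, measurable (A i)) ->
    P (\bigcap_(i in [set` J]) X i @^-1` A i) =
    (\prod_(i <- J) P (X i @^-1` A i))%E.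

Definition uniformly_distributed (R : realType) (d : nat)
    (disp : measure_display) (Omega : measurableType disp)
    (P : probability Omega R) (X : {RV P >-> torus R d}) : Prop :=
  forall A : set (torus R d), measurable A ->
    distribution P X A = torus_lebesgue d A.

Context {R : realType} {d : nat}.

(* The library's closed_ball is the closure of an open ball. *)
Definition torus_ball (x : torus R d) (r : R) : set (torus R d) :=
  [set y | mdist x y <= r].

(* Sequences are indexed from 0: l n and x n stand for l_{n+1} and x_{n+1}. *)
Definition covering_set (l : R^nat) (x : (torus R d)^nat) : set (torus R d) :=
  lim_sup_set (fun n => torus_ball (x n) (l n / 2)).

End random_covering.

Definition covering_exponent (R : realType) (d : nat) (l : R^nat) : R :=
  sup [set s : R | [/\ 0 <= s, s <= d%:R &
    (\sum_(0 <= n <oo) (l n `^ s)%:E = +oo)%E]].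

(* Main.v *)
Require Import Defs.
From mathcomp Require Import all_boot all_order all_algebra.
From mathcomp Require Import all_classical all_reals all_analysis.
From mathcomp Require Import ring lra.

(** The theorem follows from the Borel-Cantelli lemma at each piece of [F] and
a Baire category argument that glues the pieces together.

Let [alpha] be the covering exponent. Since [d - alpha < dim F], there are
[t < dim F] and [s] with [d <= s + t] such that the Hausdorff measure [H^t] of
[F] is not zero and the series of the [l_n ^ s] diverges
([covering_exponent_witness]).

A single set. Let [A] be any subset of the torus that is not [H^t]-null. The
open ball with centre [xi_k] and radius [r_k = l_k / 2] meets [A] exactly when
[xi_k] lies in the open [r_k]-neighbourhood of [A]. The volume of the
[r]-neighbourhood is at least [c r^s] for bounded [r]: cut the torus into [m^d]
cells of diameter at most [d / m], below [r] but of the same order; the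
neighbourhood contains the cells that meet [A], and these cells cover [A], so if
there were too few of them at small scales, [A] would be [H^t]-null
([thickening_volume]). The probabilities of the independent events that the
k-th ball meets [A] therefore have a divergent sum, and almost surely infinitely
many of the balls meet [A] ([ae_hit_infinitely_often]). Only the open
neighbourhoods of [A] enter, so [A] may be any set.

Gluing. Write [F] as the image of a continuous [f] on the Baire space, and keep
the points [x] such that no cylinder around [x] has an [H^t]-null image. What is
discarded has an [H^t]-null image, because there are countably many cylinders,
so every cylinder around a kept point still has a non-null image after the
discarding ([cylinder_kernel]). By the previous paragraph, applied to countably
many sets, almost surely each of the open sets [O_n], the union of the open
balls of index at least [n], meets the image of each such piece. Nested
cylinders then produce a point of [F] that lies in every [O_n]
([baire_kernel]). *)

Set Implicit Arguments.
Unset Strict Implicit.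
Unset Printing Implicit Defensive.

Import Order.TTheory GRing.Theory Num.Theory.
Import numFieldNormedType.Exports.

Local Open Scope classical_set_scope.
Local Open Scope ring_scope.

(** * Hausdorff null sets *)

Section hausdorff_null.
Local Open Scope ereal_scope.
Context {R : realType} {T : metricType R}.
Implicit Types (A B : set T) (s delta h : R).

Lemma hausdorff_weight_ge0 s (U : set T) : 0 <= hausdorff_weight s U.
Proof. by rewrite /hausdorff_weight; case: ifP => // _; exact: poweR_ge0. Qed.

Lemma hausdorff_premeasure_ge0 s delta A : 0 <= hausdorff_premeasure s delta A.
Proof.
apply: le_ereal_inf_tmp => _ [U _ <-].
by apply: nneseries_ge0 => n _ _; exact: hausdorff_weight_ge0.
Qed.

Lemma hausdorff_measure_eq0 s A : hausdorff_measure s A = 0 <->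
  forall delta, (0 < delta)%R -> hausdorff_premeasure s delta A = 0.
Proof.
split=> [A0 delta d0|A0].
  apply/le_anti; rewrite hausdorff_premeasure_ge0 andbT -A0.
  by apply: ereal_sup_ubound; exists delta.
apply/le_anti/andP; split.
  by apply: ge_ereal_sup => _ [delta d0 <-]; rewrite A0.
by apply: ereal_sup_ubound; exists 1%R; [exact: ltr01|rewrite A0].
Qed.

Lemma hausdorff_null_sub s A B : A `<=` B ->
  hausdorff_measure s B = 0 -> hausdorff_measure s A = 0.
Proof.
move=> AB /hausdorff_measure_eq0 B0; apply/hausdorff_measure_eq0 => delta d0.
apply/le_anti; rewrite hausdorff_premeasure_ge0 andbT -(B0 _ d0).
apply: le_ereal_inf => _ [U [dU BU] <-]; exists U => //; split => //.
exact: subset_trans BU.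
Qed.

(** Together with [hausdorff_null_sub], this makes the null sets a sigma-ideal,
which is all that the category argument uses of Hausdorff measure. *)
Lemma hausdorff_null_bigcup s (A : (set T)^nat) :
  (forall n, hausdorff_measure s (A n) = 0) ->
  hausdorff_measure s (\bigcup_n A n) = 0.
Proof.
move=> A0; apply/hausdorff_measure_eq0 => delta d0.
apply/le_anti; rewrite hausdorff_premeasure_ge0 andbT.
apply/lee_addgt0Pr => e e0; rewrite add0e.
have /choice[U HU] : forall n, exists U, hausdorff_cover delta (A n) U /\
    \sum_(0 <= i <oo) hausdorff_weight s (U i) <= (e / (2 ^ n.+1)%:R)%:E.
  move=> n; have en0 : (0 < e / (2 ^ n.+1)%:R)%R.
    by rewrite divr_gt0// ltr0n expn_gt0.
  have /hausdorff_measure_eq0/(_ _ d0) An0 := A0 n.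
  have : ereal_inf [set \sum_(0 <= i <oo) hausdorff_weight s (U i)
      | U in hausdorff_cover delta (A n)] < (e / (2 ^ n.+1)%:R)%:E.
    by rewrite -/(hausdorff_premeasure s delta (A n)) An0 lte_fin.
  by move=> /ereal_inf_lt[_ [U dU <-] /ltW Ue]; exists U.
(* The covers of the [A n] are listed as a single sequence along a bijection of
   [nat] with [nat * nat]. *)
have /card_esym/ppcard_eqP[f] := card_nat2.
pose V k := U (f k).1 (f k).2.
apply: (@le_trans _ _ (\sum_(0 <= i <oo) hausdorff_weight s (V i))).
  apply: ereal_inf_lbound; exists V => //; split.
    by move=> i; exact: (HU _).1.1.
  move=> x [n _ Anx]; have [j _ Ux] := (HU n).1.2 _ Anx.
  by exists (f^-1%FUN (n, j)) => //; rewrite /V invK ?inE.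
apply: le_trans (epsilon_trick0 xpredT (ltW e0)).
pose w (k : nat * nat) := hausdorff_weight s (U k.1 k.2).
have w0 k : 0 <= w k by exact: hausdorff_weight_ge0.
rewrite nneseries_esumT => [|n]; last exact: w0.
rewrite -(@reindex_esum _ _ _ setT setT f w); last by [].
rewrite (_ : [set: nat * nat] = [set: nat] `*`` (fun=> [set: nat])); last first.
  by apply/seteqP; split.
rewrite -(@esum_esum _ _ _ setT (fun=> setT) (fun i j => w (i, j)))//.
rewrite -nneseries_esumT; last by move=> n; exact: esum_ge0.
apply: lee_nneseries => n _ => [_|]; first exact: esum_ge0.
by rewrite -nneseries_esumT//; exact: (HU n).2.
Qed.

(** Indexing the cover by a finite type lets the cells of a grid be used as they
are; the empty sets that pad the cover to a sequence weigh nothing, even for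
[s = 0]. *)
Lemma hausdorff_premeasure_finite (I : finType) (J : pred I) (U : I -> set T)
    s delta r A : (0 <= s)%R -> (0 <= r <= delta)%R ->
  (forall i x y, U i x -> U i y -> (mdist x y <= r)%R) ->
  A `<=` \bigcup_(i in J) U i ->
  hausdorff_premeasure s delta A <= (#|J|%:R * r `^ s)%:E.
Proof.
move=> s0 /andP[r0 rd] dU AU; pose e := enum J.
pose V n := if onth e n is Some i then U i else set0.
have dV n : diameter (V n) <= r%:E.
  apply: ge_ereal_sup => _ [x Vx [y Vy <-]].
  move: Vx Vy; rewrite /V; case: onth => // i Ux Uy.
  by rewrite lee_fin; exact: (dU i).
have wV n : hausdorff_weight s (V n) <= (r `^ s)%:E.
  rewrite /hausdorff_weight; case: ifPn => [_|/set0P[x Vx]].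
    by rewrite lee_fin powR_ge0.
  rewrite -poweR_EFin; apply: gt0_ler_poweR => //.
    rewrite in_itv/= leey andbT; apply: ereal_sup_ubound; exists x => //.
    by exists x => //; rewrite mdistxx.
  by rewrite in_itv/= leey andbT lee_fin.
apply: (@le_trans _ _ (\sum_(0 <= i <oo) hausdorff_weight s (V i))).
  apply: ereal_inf_lbound; exists V => //; split.
    by move=> n; rewrite (le_trans (dV n))// lee_fin.
  move=> x /AU[i Ji Uix]; have ie : i \in e by rewrite mem_enum.
  exists (index i e) => //.
  by rewrite /V onthE (nth_map i) ?index_mem// nth_index.
rewrite (nneseries_split 0%N (size e)); last first.
  by move=> k _; exact: hausdorff_weight_ge0.
rewrite [X in _ + X]eseries0 ?adde0; last first.
  move=> k; rewrite add0n => ek _; rewrite /V onth_default//.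
  by rewrite /hausdorff_weight eqxx.
rewrite add0n cardE -/e EFinM mule_natl.
rewrite (le_trans (lee_sum _ (fun i _ => wV i)))//.
by rewrite sumr_const_nat subn0.
Qed.

Lemma hausdorff_measure_set0 s : (0 <= s)%R -> hausdorff_measure s (@set0 T) = 0.
Proof.
move=> s0; apply/hausdorff_measure_eq0 => delta d0.
apply/le_anti; rewrite hausdorff_premeasure_ge0 andbT.
have := @hausdorff_premeasure_finite void pred0 (fun=> set0) s delta delta set0.
by rewrite card0 mul0r; apply => //; rewrite lexx ltW.
Qed.

(** The premeasure may be infinite; a positive real below it is what a finite
cover can be compared with. *)
Lemma hausdorff_premeasure_pos s A : hausdorff_measure s A <> 0 ->
  exists2 delta, (0 < delta)%R &
    exists2 h, (0 < h)%R & h%:E <= hausdorff_premeasure s delta A.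
Proof.
move=> A0; have [delta d0 Ad] : exists2 delta, (0 < delta)%R &
    hausdorff_premeasure s delta A <> 0.
  apply: contrapT => H; apply/A0/hausdorff_measure_eq0 => delta d0.
  by apply: contrapT => Ad; apply: H; exists delta.
have prem0 : 0 < hausdorff_premeasure s delta A.
  by rewrite lt_neqAle hausdorff_premeasure_ge0 andbT eq_sym; apply/eqP.
exists delta => //; move: prem0; case: (hausdorff_premeasure s delta A) => [h||]//.
  by rewrite lte_fin; exists h.
by move=> _; exists 1%R => //; rewrite leey.
Qed.

End hausdorff_null.

(** * The second Borel-Cantelli lemma *)

Lemma divergent_tail_sums (R : realType) (p : R^nat) (n : nat) (M : R) :
  (forall k, 0 <= p k) -> (\sum_(0 <= k <oo) (p k)%:E = +oo)%E ->
  exists m, M <= \sum_(k <- index_iota n m) p k.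
Proof.
move=> p0 poo; apply: contrapT => /forallNP H.
have p0E k : (0 <= (p k)%:E)%E by rewrite lee_fin.
suff : (\sum_(0 <= k <oo) (p k)%:E <=
    (\sum_(0 <= k < n) p k + M)%:E)%E by rewrite poo leye_eq.
rewrite (nneseries_split 0%N n)// add0n EFinD sumEFin leeD2l//.
apply: lime_le; first exact: is_cvg_nneseries.
apply: nearW => m; rewrite sumEFin lee_fin ltW// ltNge.
exact/negP/H.
Qed.

(** The probability that no [X k] with [k >= n] lands in [V k] is at most
[\prod_k (1 - p k) <= exp (- \sum_k p k)] over any finite range of indices
[k >= n], hence it vanishes. *)
Lemma second_borel_cantelli (R : realType) (d d' : measure_display)
    (Omega : measurableType d) (T : measurableType d') (P : probability Omega R)
    (X : nat -> {RV P >-> T}) (V : nat -> set T) (p : R^nat) :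
  mutually_independent X -> (forall k, measurable (V k)) ->
  (forall k, 0 <= p k) -> (forall k, ((p k)%:E <= P (X k @^-1` V k))%E) ->
  (\sum_(0 <= k <oo) (p k)%:E = +oo)%E ->
  {ae P, forall w, forall n, exists2 k, (n <= k)%N & V k (X k w)}.
Proof.
move=> indep mV p0 pV poo; apply: ae_foralln => n.
have mX k : measurable (X k @^-1` ~` V k).
  by rewrite -[X in measurable X]setTI; apply: measurable_funP => //;
    exact: measurableC.
pose B := \bigcap_(k in [set k | (n <= k)%N]) X k @^-1` ~` V k.
exists B; split; first exact: bigcap_measurableType.
- apply/le_anti; rewrite measure_ge0 andbT.
  apply/lee_addgt0Pr => e e0; rewrite add0e.
  (* [m] is chosen so that [exp (- \sum_(n <= k < m) p k) <= e]. *)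
  have [m me] := @divergent_tail_sums R p n (- ln e) p0 poo.
  have -> : e = expR (- - ln e) by rewrite opprK lnK// posrE.
  pose J := index_iota n m.
  apply: (@le_trans _ _ (P (\bigcap_(k in [set` J]) X k @^-1` ~` V k))).
    apply: le_measure; rewrite ?inE//; first exact: bigcap_measurableType.
      exact: bigcap_measurableType.
    move=> w Bw k /=; rewrite mem_index_iota => /andP[nk _]; exact: Bw.
  rewrite indep ?iota_uniq//; last by move=> k; exact: measurableC.
  apply: (@le_trans _ _ (expR (- \sum_(k <- J) p k))%:E); last first.
    by rewrite lee_fin ler_expR lerN2.
  rewrite -sumrN; elim: J => [|k J IH]; first by rewrite !big_nil expR0.
  rewrite !big_cons expRD EFinM lee_pmul//; first exact: prode_ge0.
  rewrite -[X in P X]/(~` (X k @^-1` V k)) probability_setC; last first.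
    by rewrite -[X in measurable X]setTI; exact: measurable_funP.
  apply: (@le_trans _ _ (1 - (p k)%:E)%E); first exact: leeB.
  by rewrite -EFinB lee_fin expR_ge1Dx.
- by move=> w /forall2NP H k /= nk Vk; have [] := H k.
Qed.

(** * Volume of neighbourhoods in the torus *)

Section grid.
Context {R : realType}.
Local Notation mR := (measurableTypeR R).

Lemma uniform_prob01_itv (a b : R) : 0 <= a -> a < b -> b <= 1 ->
  uniform_prob (@ltr01 R) `[a, b[ = (b - a)%:E.
Proof.
move=> a0 ab b1; rewrite /uniform_prob.
rewrite (eq_integral (cst 1%:E)) => [|x].
  by rewrite integral_cst//= mul1e lebesgue_measure_itv/= lte_fin ab EFinB.
rewrite inE/= in_itv/= => /andP[ax xb].
by rewrite /uniform_pdf (le_trans a0 ax) (ltW (lt_le_trans xb b1)) subr0 invr1.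
Qed.

(** Half-open intervals make the cells disjoint while they still cover the
half-open cube, a fundamental domain of the torus. *)
Definition grid_itv (m k : nat) : set mR := `[k%:R / m%:R, k.+1%:R / m%:R[.

Definition grid_cell (m d : nat) (j : d.-tuple 'I_m) : set (d.-tuple mR) :=
  [set x | forall i, grid_itv m (tnth j i) (tnth x i)].

Lemma measurable_grid_cell m d (j : d.-tuple 'I_m) : measurable (grid_cell j).
Proof.
rewrite (_ : grid_cell j = \bigcap_(i in [set: 'I_d])
    (fun x : d.-tuple mR => tnth x i) @^-1` grid_itv m (tnth j i)).
  apply: fin_bigcap_measurable => [|i _]; first exact: finite_finset.
  rewrite -[X in measurable X]setTI.
  by apply: (measurable_tnth i) => //; exact: measurable_itv.
by apply/seteqP; split => x jx i; [move=> _|]; exact: jx.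
Qed.

Lemma grid_itv_inj m (k k' : nat) (x : R) : (0 < m)%N ->
  grid_itv m k x -> grid_itv m k' x -> k = k'.
Proof.
move=> m0; have m0' : 0 < m%:R :> R by rewrite ltr0n.
rewrite /grid_itv/= !in_itv/= !ler_pdivrMr// !ltr_pdivlMr//.
move=> /andP[kx xk] /andP[kx' xk'].
have := le_lt_trans kx xk'; have := le_lt_trans kx' xk.
by rewrite !ltr_nat !ltnS => ? ?; apply/eqP; rewrite eqn_leq; apply/andP.
Qed.

Lemma trivIset_grid_cell m d (J : set (d.-tuple 'I_m)) : (0 < m)%N ->
  trivIset J (@grid_cell m d).
Proof.
move=> m0 j j' _ _ [x [jx j'x]]; apply: eq_from_tnth => i; apply: val_inj.
exact: (@grid_itv_inj m _ _ (tnth x i) m0 (jx i) (j'x i)).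
Qed.

Lemma cube_prob_grid_cell m d (j : d.-tuple 'I_m) : (0 < m)%N ->
  cube_prob d (grid_cell j) = (m%:R^-1 ^+ d)%:E.
Proof.
move=> m0; elim: d j => [|d IH] j.
  by rewrite /= diracE mem_set//; case.
case/tupleP: j => k j.
have -> : cube_prob d.+1 (grid_cell [tuple of k :: j]) =
    (uniform_prob (@ltr01 R) \x cube_prob d)%E
      (tuple_of_cons (n := d) @^-1` grid_cell [tuple of k :: j]) by [].
rewrite (_ : _ @^-1` _ = grid_itv m k `*` grid_cell j); last first.
  apply/seteqP; split => [[x y] /= H|[x y] /= [H1 H2] i].
    split; first by have := H ord0; rewrite !tnth0.
    by move=> i; have := H (lift ord0 i); rewrite !tnthS.
  by case: (unliftP ord0 i) => [i' ->|->]; rewrite ?tnthS ?tnth0//; exact: H2.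
have m0' : 0 < m%:R :> R by rewrite ltr0n.
rewrite product_measure1E; [|exact: measurable_itv|exact: measurable_grid_cell].
(* The measure is seen through a coercion that hides [cube_prob] from
   rewriting. *)
transitivity (uniform_prob (@ltr01 R) (grid_itv m k) *
  cube_prob d (grid_cell j))%E; first by [].
rewrite IH uniform_prob01_itv.
- rewrite -EFinM exprS; congr (_ * _)%:E.
  by rewrite -mulrBl -natrB// subSnn mul1r.
- by rewrite divr_ge0.
- by rewrite ltr_pM2r ?invr_gt0// ltr_nat.
- by rewrite ler_pdivrMr// mul1r ler_nat.
Qed.

Lemma cube_prob_grid_cells m d (J : pred (d.-tuple 'I_m)) : (0 < m)%N ->
  cube_prob d (\bigcup_(j in [set` J]) grid_cell j) =
    (#|J|%:R * m%:R^-1 ^+ d)%:E.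
Proof.
move=> m0; have -> : [set` J] = [set` enum J].
  by apply/seteqP; split => j /=; rewrite mem_enum.
rewrite measure_fin_bigcup//; last 2 first.
- exact: trivIset_grid_cell.
- by move=> j _; exact: measurable_grid_cell.
rewrite -fsbig_seq ?enum_uniq//.
transitivity (\sum_(j <- enum J) (m%:R^-1 ^+ d : R)%:E)%E.
  by apply: eq_bigr => j _; exact: cube_prob_grid_cell.
by rewrite sumEFin big_const_seq count_predT -cardE iter_addr_0 mulr_natl.
Qed.

Lemma grid_cell_dist m d (j : d.-tuple 'I_m) (x y : d.-tuple mR) : (0 < m)%N ->
  grid_cell j x -> grid_cell j y ->
  mdist (torus_proj x) (torus_proj y) <= d%:R / m%:R.
Proof.
move=> m0 jx jy; have m0' : 0 < m%:R :> R by rewrite ltr0n.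
apply: le_trans (tdist_le _ _) _; apply: le_trans (enorm_le_sum _) _.
rewrite -[d in leRHS]card_ord -sum1_card natr_sum mulr_suml.
apply: ler_sum => i _; rewrite !mxE mul1r.
have := jx i; have := jy i; rewrite /grid_itv/= !in_itv/=.
rewrite -natr1 mulrDl mul1r => /andP[? ?] /andP[? ?].
by rewrite ler_norml; apply/andP; split; lra.
Qed.

Lemma grid_cell_cover m d (p : torus R d) : (0 < m)%N ->
  exists j : d.-tuple 'I_m, exists2 x, grid_cell j x & torus_proj x = p.
Proof.
move=> m0; have m0' : 0 < m%:R :> R by rewrite ltr0n.
pose f i := repr p 0 i - (Num.floor (repr p 0 i))%:~R.
have f0 i : 0 <= f i by rewrite subr_ge0 floor_le.
have f1 i : f i < 1.
  by rewrite ltrBlDl; have := floorD1_gt (repr p 0 i); rewrite intrD.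
have fm i : (Num.truncn (f i * m%:R) < m)%N.
  by rewrite truncn_lt_nat ?mulr_ge0// -[ltRHS]mul1r ltr_pM2r.
exists [tuple Ordinal (fm i) | i < d], [tuple f i | i < d].
  move=> i; rewrite !tnth_mktuple /grid_itv/= in_itv/=.
  by rewrite ler_pdivrMr// ltr_pdivlMr// truncn_itv// mulr_ge0.
rewrite -[RHS]tpi_repr; apply/tpiP => i; rewrite mxE tnth_mktuple /f.
by rewrite addrAC subrr add0r rpredN intr_int.
Qed.

End grid.

Section thickening.
Context {R : realType}.

Definition thickening {T : metricType R} (A : set T) (r : R) : set T :=
  [set y | exists2 a, A a & mdist a y < r].

Lemma open_thickening (T : metricType R) (A : set T) r : open (thickening A r).
Proof.
rewrite openE => y [a Aa ay]; rewrite /interior -nbhs_ballE.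
exists (r - mdist a y) => /=; first by rewrite subr_gt0.
move=> z; rewrite ballEmdist/= => yz; exists a => //.
by rewrite (le_lt_trans (metric_triangle a y z))// -ltrBrDl.
Qed.

End thickening.

Section thickening_volume.
Context {R : realType} {d : nat}.
Implicit Types A : set (torus R d).

Lemma measurable_thickening A r : measurable (thickening A r).
Proof. by apply: sub_sigma_algebra; exact: open_thickening. Qed.

(** Let [N] be the number of cells of the grid of mesh [1 / m] that meet [A].
These cells cover [A], so [h <= N (d / m)^t]; they are disjoint, have volume
[m^-d] and lie in the thickening, whose volume is thus at least [N m^-d]. *)
Lemma thickening_grid_volume A t delta h r m :
  0 <= t -> (h%:E <= hausdorff_premeasure t delta A)%E ->
  (0 < d)%N -> (0 < m)%N -> d%:R / m%:R < r -> d%:R / m%:R <= delta ->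
  ((h * (d%:R / m%:R) `^ (- t) * m%:R `^ (- d%:R))%:E
    <= torus_lebesgue d (thickening A r))%E.
Proof.
move=> t0 hA d0 m0 mr mdelta; have m0' : 0 < m%:R :> R by rewrite ltr0n.
have dm0 : 0 < d%:R / m%:R :> R by rewrite divr_gt0// ltr0n.
pose J : pred (d.-tuple 'I_m) :=
  [pred j | `[< exists2 x, grid_cell j x & A (torus_proj x) >] ].
have AJ : A `<=` \bigcup_(j in J) (@torus_proj R d @` grid_cell j).
  move=> p Ap; have [j [x jx xp]] := @grid_cell_cover R m d p m0.
  exists j; last by exists x.
  by apply/asboolP; exists x => //; rewrite xp.
have hJ : h <= #|J|%:R * (d%:R / m%:R) `^ t.
  rewrite -lee_fin (le_trans hA)//; apply: hausdorff_premeasure_finite AJ => //.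
    by rewrite ltW.
  by move=> j _ _ [x jx <-] [y jy <-]; exact: grid_cell_dist jx jy.
apply: (@le_trans _ _ (#|J|%:R * m%:R^-1 ^+ d)%:E).
  rewrite lee_fin powR_invn ?exprVn ?ler_wpM2r ?invr_ge0 ?exprn_ge0//.
  by rewrite powRN ler_pdivrMr// powR_gt0.
rewrite -cube_prob_grid_cells//; apply: le_measure; rewrite ?inE.
- by apply: fin_bigcup_measurable => // j _; exact: measurable_grid_cell.
- rewrite -[X in measurable X]setTI; apply: measurable_torus_proj => //.
  exact: measurable_thickening.
move=> x [j /asboolP[y jy Ay] jx]; exists (torus_proj y) => //.
exact: le_lt_trans (grid_cell_dist m0 jy jx) mr.
Qed.

(** The mesh is taken just fine enough for the grid estimate at a radius
proportional to [r], so that [m] is of order [1 / r] and the lower bound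
[m^(t - d) >= m^-s] is of order [r^s]. Asking for every [r <= rho], not only
for small [r], covers ball sizes that do not tend to 0. *)
Lemma thickening_volume A t s rho : (0 < d)%N -> 0 <= t -> 0 <= s ->
  d%:R <= s + t -> 0 < rho -> hausdorff_measure t A <> 0%E ->
  exists2 c, 0 < c & forall r, 0 < r <= rho ->
    ((c * r `^ s)%:E <= torus_lebesgue d (thickening A r))%E.
Proof.
move=> d0 t0 s0 dst rho0 /hausdorff_premeasure_pos[delta delta0 [h h0 hA]].
have d0' : 0 < d%:R :> R by rewrite ltr0n.
pose eps := Num.min (Num.min delta d%:R) rho.
have eps0 : 0 < eps by rewrite !lt_min delta0 d0' rho0.
exists (h * d%:R `^ (- t) * (eps / rho / (2 * d%:R)) `^ s).
  by rewrite !mulr_gt0// powR_gt0// !divr_gt0// mulr_gt0.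
(* Scaling [r] down linearly, so that [rho] becomes [eps], brings it below
   [delta], where the premeasure is known to be large, and below [d], where the
   rounding in [m] costs at most a factor 2. *)
move=> r /andP[r0 rrho]; pose r' := eps / rho * r.
have r'0 : 0 < r' by rewrite !mulr_gt0// invr_gt0.
have r'r : r' <= r.
  by rewrite -[leRHS]mul1r ler_pM2r// ler_pdivrMr// mul1r ge_min lexx orbT.
have r'eps : r' <= eps.
  by rewrite /r' mulrAC -mulrA ler_piMr ?(ltW eps0)// ler_pdivrMr// mul1r.
pose m := (Num.truncn (d%:R / r')).+1.
have m0 : 0 < m%:R :> R by rewrite ltr0n.
have dm : d%:R / m%:R < r'.
  by rewrite ltr_pdivrMr// mulrC -ltr_pdivrMr//; exact: truncnS_gt.
have r'delta : r' <= delta by rewrite (le_trans r'eps)// !ge_min lexx.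
have r'd : r' <= d%:R by rewrite (le_trans r'eps)// !ge_min lexx orbT.
have := @thickening_grid_volume A t delta h r m t0 hA d0 isT
  (lt_le_trans dm r'r) (ltW (lt_le_trans dm r'delta)).
apply: le_trans; rewrite lee_fin.
have mV (u : R) : m%:R^-1 `^ u = m%:R `^ (- u).
  by rewrite -powR_inv1 ?(ltW m0)// -powRrM mulN1r.
have mr' : r' / (2 * d%:R) <= m%:R^-1.
  rewrite -[leLHS]invrK lef_pV2 ?posrE ?invr_gt0 ?divr_gt0 ?mulr_gt0 ?invr_gt0//.
  rewrite invf_div (_ : _ / r' = d%:R / r' + d%:R / r').
    rewrite /m -[leLHS]natr1 lerD//; first by rewrite truncn_le// divr_ge0// ltW.
    by rewrite ler_pdivlMr// mul1r.
  by field; rewrite gt_eqF.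
rewrite [(d%:R / m%:R) `^ _]powRM ?invr_ge0 ?(ltW d0') ?(ltW m0)// mV opprK.
rewrite [h * (_ * _)]mulrA -[leLHS]mulrA -[leRHS]mulrA.
rewrite ler_pM2l ?mulr_gt0 ?powR_gt0// -powRD; last first.
  by apply/implyP => _; rewrite gt_eqF.
rewrite -powRM ?(ltW r0)//; last by rewrite !divr_ge0 ?mulr_ge0 ?ltW.
rewrite (_ : _ * r = r' / (2 * d%:R)); last by rewrite /r' mulrAC.
apply: (@le_trans _ _ (m%:R^-1 `^ s)).
  have r'2d : 0 <= r' / (2 * d%:R) by rewrite ltW// divr_gt0// mulr_gt0.
  by apply: ge0_ler_powR => //; rewrite nnegrE// invr_ge0 ltW.
by rewrite mV ler_powR ?ler1n//; lra.
Qed.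

End thickening_volume.

(** * Baire category on the Baire space modulo a sigma-ideal *)

(** Cylinders are indexed by finite words, of which there are countably many. *)
Definition cylinder (u : seq nat) : set {ptws nat -> nat} :=
  [set x | mkseq x (size u) = u].

Lemma cylinder_mkseqP (x y : {ptws nat -> nat}) n :
  cylinder (mkseq x n) y <-> forall i, (i < n)%N -> y i = x i.
Proof.
rewrite /cylinder/= size_mkseq; split=> [yx i ni|yx].
  by have := congr1 (nth 0%N ^~ i) yx; rewrite !nth_mkseq.
by apply/eq_in_map => i; rewrite mem_iota add0n => /yx.
Qed.

(** Otherwise points outside [V], the n-th in the n-th cylinder around [x],
would converge pointwise to [x]. *)
Lemma nbhs_cylinder (x : {ptws nat -> nat}) (V : set {ptws nat -> nat}) :
  nbhs x V -> exists n, cylinder (mkseq x n) `<=` V.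
Proof.
move=> Vx; apply: contrapT => /forallNP H.
have /choice[y yP] : forall n, exists y, cylinder (mkseq x n) y /\ ~ V y.
  by move=> n; have /existsNP[y /not_implyP] := H n; exists y.
have /(_ _ Vx)[n _ /(_ n (leqnn n))] : y @ \oo --> (x : {ptws nat -> nat}).
  apply/pointwise_cvgP => i.
  apply: cvg_near_cst; exists i.+1 => // n /= ni.
  by have [/cylinder_mkseqP/(_ _ ni)] := yP n.
exact: (yP n).2.
Qed.

Section baire.
Context {T : topologicalType}.
Variables (N : set (set T)) (f : {ptws nat -> nat} -> T).
Hypothesis N_sub : forall A B, A `<=` B -> N B -> N A.
Hypothesis N_bigcup : forall A : (set T)^nat,
  (forall n, N (A n)) -> N (\bigcup_n A n).
Hypothesis f_cont : continuous f.

(** The points all of whose cylinders have an image outside the ideal [N]: the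
analogue for [N] of the perfect kernel in the Cantor-Bendixson theorem. *)
Definition positive_kernel : set {ptws nat -> nat} :=
  [set x | forall n, ~ N (f @` cylinder (mkseq x n))].

(** A point outside the kernel lies in a cylinder whose image is in [N]. There
are countably many such cylinders, so leaving the kernel costs only a set of
[N]. *)
Lemma cylinder_kernel u :
  ~ N (f @` cylinder u) -> ~ N (f @` (cylinder u `&` positive_kernel)).
Proof.
apply: contra_not => Nu.
(* Index 0 holds the part in the kernel, index [k + 1] the cylinder of code [k]
   when its image is in [N]. *)
pose B k := if k is k.+1 then
    \bigcup_(v in [set v | unpickle k = Some v /\ N (f @` cylinder v)])
      f @` cylinder v
  else f @` (cylinder u `&` positive_kernel).
apply: (@N_sub _ (\bigcup_k B k)) => [_ [x ux <-]|].
  have [kx|/existsNP[n /contrapT Nn]] := pselect (positive_kernel x).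
    by exists 0%N => //; exists x.
  exists (pickle (mkseq x n)).+1 => //; exists (mkseq x n).
    by split => //; exact: pickleK.
  by exists x => //; exact/cylinder_mkseqP.
apply: N_bigcup => -[//|k] /=.
have [[v [kv Nv]]|nv] := pselect (exists v,
    unpickle k = Some v /\ N (f @` cylinder v)); last first.
  by apply: N_sub Nu => y [v kv _]; case: nv; exists v.
by apply: N_sub Nv => y [v' []]; rewrite kv => -[<-].
Qed.

(** The Baire category theorem on the kernel: the preimage of each [O n] is open,
and dense in the kernel by hypothesis. *)
Lemma baire_kernel (O : (set T)^nat) : (forall n, open (O n)) ->
  (forall u n, ~ N (f @` cylinder u) ->
     exists2 x, (cylinder u `&` positive_kernel) x & O n (f x)) ->
  ~ N (range f) -> exists x, (\bigcap_n O n) (f x).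
Proof.
move=> oO hitO Nf.
pose st := ({ptws nat -> nat} * nat)%type.
(* A state is a point of the kernel with the length of the prefix fixed so far;
   step [j] moves within the current cylinder to a smaller one that [f] maps
   into [O j]. *)
have /choice[next nextP] : forall a : nat * st, exists b : st,
    positive_kernel a.2.1 ->
    [/\ positive_kernel b.1, cylinder (mkseq a.2.1 a.2.2) b.1,
      (a.2.2 < b.2)%N & f @` cylinder (mkseq b.1 b.2) `<=` O a.1].
  move=> [j [x n]] /=.
  have [kx|nkx] := pselect (positive_kernel x); last by exists (x, n).
  have [y [xy ky] Oy] := hitO _ j (kx n).
  have /nbhs_cylinder[m mO] : nbhs y (f @^-1` O j).
    by apply: f_cont; apply: open_nbhs_nbhs; split.
  exists (y, maxn m n.+1) => _; split => //=; first by rewrite leq_maxr.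
  move=> _ [z /cylinder_mkseqP yz <-]; apply: mO; apply/cylinder_mkseqP => i im.
  by apply: yz; rewrite (leq_trans im)// leq_maxl.
have [x0 kx0] : positive_kernel !=set0.
  have [|x [_ kx] _] := hitO [::] 0%N; last by exists x.
  by apply: contra_not Nf; apply: N_sub => _ [x _ <-]; exists x.
pose s := fix s j : st := if j is j.+1 then next (j, s j) else (x0, 0%N).
have ks j : positive_kernel (s j).1.
  by elim: j => [//|j IH]; have [] := nextP (j, s j) IH.
have sS j := nextP (j, s j) (ks j).
have sz j : (j <= (s j).2)%N.
  by elim: j => // j IH; apply: (leq_ltn_trans IH); have [] := sS j.
have s_mono j k : (j <= k)%N -> ((s j).2 <= (s k).2)%N.
  move=> /subnK <-; elim: (k - j)%N => // i IH.
  by apply: (leq_trans IH); rewrite addSn ltnW//; have [] := sS (i + j)%N.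
have sE j k i : (j <= k)%N -> (i < (s j).2)%N -> (s k).1 i = (s j).1 i.
  move=> /subnK <-; elim: (k - j)%N => // p IH ij; rewrite -IH// addSn.
  have [_ /cylinder_mkseqP/(_ i) -> //] := sS (p + j)%N.
  by rewrite (leq_trans ij)// s_mono// leq_addl.
(* After step [i + 1] at least [i + 1] letters are fixed, the i-th among them. *)
pose z : {ptws nat -> nat} := fun i => (s i.+1).1 i.
have zE j : cylinder (mkseq (s j).1 (s j).2) z.
  apply/cylinder_mkseqP => i ij; rewrite /z.
  have [ji|ji] := leqP j i.+1; first exact: sE.
  by rewrite (sE _ _ i (ltnW ji) (sz i.+1)).
exists z => j _; have [_ _ _] := sS j; apply; exists z => //.
exact: zE j.+1.
Qed.

End baire.

(** * Random covering sets *)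

Section exponents.
Context {R : realType}.

(** Both [alpha] as a supremum and the dimension as an infimum leave room for a
choice: [t] strictly between [d - alpha] and [dim F], then [s > d - t] in the
set that defines [alpha]. *)
Lemma covering_exponent_witness (d : nat) (l : R^nat) (T : metricType R)
    (F : set T) :
  ((d%:R - covering_exponent d l)%:E < hausdorff_dim F)%E ->
  exists t s, [/\ 0 <= t, 0 <= s, d%:R <= s + t,
    (\sum_(0 <= n <oo) (l n `^ s)%:E = +oo)%E & hausdorff_measure t F <> 0%E].
Proof.
rewrite /covering_exponent; set S := [set s | _] => dimF.
have S0 : S 0.
  split=> //; apply/eqyP => M M0.
  apply: (le_trans _ (nneseries_lim_ge (Num.truncn M).+1 _)).
    under eq_bigr do rewrite powRr0.
    by rewrite sumEFin lee_fin sumr_const_nat subn0 ltW// truncnS_gt.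
  by move=> k _; rewrite lee_fin powR_ge0.
have supS : sup S <= d%:R by apply: ge_sup => [|s []//]; exists 0.
have [t dt tF] : exists2 t, d%:R - sup S < t & (t%:E < hausdorff_dim F)%E.
  case: (hausdorff_dim F) dimF => [D||]//.
    by rewrite lte_fin => /midf_lt[? ?]; exists ((d%:R - sup S + D) / 2).
  by move=> _; exists (d%:R - sup S + 1); rewrite ?ltrDl ?ltry.
have [s [s0 sd ls] st] : exists2 s, S s & d%:R - t < s.
  by apply: sup_gt; [exists 0|rewrite ltrBlDr -ltrBlDl].
exists t, s; split => //.
- by rewrite ltW// (le_lt_trans _ dt)// subr_ge0.
- by rewrite -lerBlDr ltW.
move=> tF0; move: tF; rewrite ltNge => /negP; apply.
apply: ereal_inf_lbound; exists t => //; split => //.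
by rewrite ltW// (le_lt_trans _ dt)// subr_ge0.
Qed.

End exponents.

Section random_hitting.
Context {R : realType} {d : nat}.

(** The k-th open ball meets [A] exactly when its centre falls in the
[l k / 2]-thickening of [A], which is open: the events are measurable, and
independent because the centres are. *)
Lemma ae_hit_infinitely_often (d_gt0 : (0 < d)%N)
    (l : R^nat) (l_gt0 : forall n, 0 < l n) (l_decr : nonincreasing_seq l)
    (disp : measure_display) (Omega : measurableType disp)
    (P : probability Omega R) (xi : nat -> {RV P >-> torus R d})
    (xi_indep : mutually_independent xi)
    (xi_unif : forall n, uniformly_distributed (xi n))
    (A : set (torus R d)) (t s : R) :
  0 <= t -> 0 <= s -> d%:R <= s + t ->
  (\sum_(0 <= n <oo) (l n `^ s)%:E = +oo)%E ->
  hausdorff_measure t A <> 0%E ->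
  {ae P, forall w, forall n, exists2 k, (n <= k)%N &
    exists2 a, A a & mdist a (xi k w) < l k / 2}.
Proof.
move=> t0 s0 dst ls At.
have l20 k : 0 < l k / 2 by rewrite divr_gt0.
have [c c0 cA] := thickening_volume d_gt0 t0 s0 dst (l20 0%N) At.
apply: (@second_borel_cantelli _ _ _ _ _ P xi (fun k => thickening A (l k / 2))
  (fun k => c * (l k / 2) `^ s)) => //.
- by move=> k; exact: measurable_thickening.
- by move=> k; rewrite mulr_ge0 ?powR_ge0 ?ltW.
- move=> k; rewrite -[leRHS]/(distribution P (xi k) _) xi_unif; last first.
    exact: measurable_thickening.
  by apply: cA; rewrite l20 ler_pM2r ?invr_gt0// l_decr.
under eq_eseriesr do rewrite powRM ?invr_ge0 ?(ltW (l_gt0 _))// mulrCA mulrC EFinM.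
rewrite nneseriesZl; last by move=> k _; rewrite lee_fin powR_ge0.
by rewrite ls gt0_muley// lte_fin mulr_gt0 ?powR_gt0 ?invr_gt0.
Qed.

End random_hitting.

Theorem theorem1p1 (R : realType) (d : nat) (d_gt0 : (0 < d)%N)
    (l : R^nat) (l_gt0 : forall n, 0 < l n) (l_decr : nonincreasing_seq l)
    (disp : measure_display) (Omega : measurableType disp)
    (P : probability Omega R) (xi : nat -> {RV P >-> torus R d})
    (xi_indep : mutually_independent xi)
    (xi_unif : forall n, uniformly_distributed (xi n))
    (F : set (torus R d)) (F_analytic : analytic F)
    (F_dim : ((d%:R - covering_exponent d l)%:E < hausdorff_dim F)%E) :
  {ae P, forall w, covering_set l (fun n => xi n w) `&` F !=set0}.
Proof.
have [t [s [t0 s0 dst ls Ft]]] := covering_exponent_witness F_dim.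
have [F0|[f f_cont Ff]] := F_analytic.
  by exfalso; apply: Ft; rewrite F0; exact: hausdorff_measure_set0.
pose N := [set A : set (torus R d) | hausdorff_measure t A = 0%E].
have N_sub A B : A `<=` B -> N B -> N A by exact: hausdorff_null_sub.
have N_bigcup (A : (set (torus R d))^nat) : (forall n, N (A n)) ->
  N (\bigcup_n A n) by exact: hausdorff_null_bigcup.
(* Words are enumerated by their codes, so that countably many almost sure
   statements are combined. *)
have hit : {ae P, forall w, forall j, forall u, unpickle j = Some u ->
    ~ N (f @` cylinder u) -> forall n, exists2 k, (n <= k)%N &
    exists2 a, (f @` (cylinder u `&` positive_kernel N f)) a &
      mdist a (xi k w) < l k / 2}.
  apply: ae_foralln => j; case: (unpickle j) => [u|]; last exact: aeW.
  have [Nu|/(cylinder_kernel N_sub N_bigcup) Nu] := pselect (N (f @` cylinder u)).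
    by apply: aeW => w _ [<-].
  apply: filterS (ae_hit_infinitely_often d_gt0 l_gt0 l_decr xi_indep xi_unif
    t0 s0 dst ls Nu) => w H _ [<-] _.
  exact: H.
apply: filterS hit => w hit.
pose O n := \bigcup_(k in [set k | (n <= k)%N]) thickening [set xi k w] (l k / 2).
have [|u n Nu||x Ox] := @baire_kernel _ N f N_sub f_cont O.
- move=> n; apply: bigcup_open => k _; exact: open_thickening.
- have [k nk [_ [x ux <-] xk]] := hit _ _ (pickleK u) Nu n.
  exists x => //; exists k => //; exists (xi k w) => //.
  by rewrite metric_sym.
- by rewrite -Ff.
exists (f x); split; last by rewrite Ff; exists x.
by move=> n _; have [k nk [_ -> /ltW xk]] := Ox n I; exists k.
Qed.
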